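(* Let $k,l\ge 2$ be integers such that the pair $(k,l)$ admits a stability graph $F$ which is strict. Then there is $n_0$ such that every graph $G$ with $n=v(G)\ge n_0$, $\alpha(G)<l$, and $P(K_k,G)=f(n,k,l)$ contains an expansion of $F$ as a spanning subgraph (that is, with $V(F)=[m]$, there is a partition $V(G)=V_1\cup\dots\cup V_m$ with $E(F(\!(V_1,\dots,V_m)\!))\subseteq E(G)$).
   Context: All graphs are finite and simple. $v(G)$ is the order, $\alpha(G)$ the independence number of $G$, $\overline K_r$ the edgeless graph on $r$ vertices. $P(K_k,G)$ is the number of $k$-cliques in $G$ and $p(K_k,G)=P(K_k,G)/\binom{v(G)}{k}$. Define $$f(n,k,l)=\min\{P(K_k,G) : v(G)=n,\ \alpha(G)<l\},\qquad c_{k,l}=\lim_{n\to\infty}\frac{f(n,k,l)}{\binom{n}{k}}$$ (the limit is known to exist). Expansion: given a graph $F$ with vertex set $[m]=\{1,\dots,m\}$ and disjoint sets $V_1,\dots,V_m$, $F(\!(V_1,\dots,V_m)\!)$ is the graph on $V_1\cup\dots\cup V_m$ obtained by putting the complete graph on each $V_i$ and, for each edge $\{i,j\}\in E(F)$, the complete bipartite graph between $V_i$ and $V_j$ (and no other edges). Let $F$ be a graph with vertex set $[m]$ and $\alpha(F)<l$. $F$ is a stability graph for $(k,l)$ if for every $\varepsilon>0$ there are $n_0$ and $\delta>0$ such that for every graph $G$ with $n=v(G)\ge n_0$, $\alpha(G)<l$ and $p(K_k,G)\le c_{k,l}+\delta$ there is a partition $V(G)=V_1\cup\dots\cup V_m$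 with part sizes differing by at most $1$ and $$|E(F(\!(V_1,\dots,V_m)\!))\bigtriangleup E(G)|\le\varepsilon\binom n2.$$ A set $X\subseteq[m]$ is legal if $F-X$ (the subgraph of $F$ induced by $[m]\setminus X$) does not contain $\overline K_{l-1}$ as an induced subgraph. The gradient $\mathrm{grad}(X)$ is the probability, when $k-1$ independent uniformly distributed vertices $x_1,\dots,x_{k-1}\in[m]$ are picked, that all of them belong to $X$ and for every $i,j\in[k-1]$ the vertices $x_i$ and $x_j$ are adjacent in $F$ or equal. For $i\in[m]$, $\hat\Gamma_F(i)=\{i\}\cup\{j\in V(F): \{i,j\}\in E(F)\}$ is the closed neighbourhood of $i$. A stability graph $F$ is strict if $\mathrm{grad}(X)>c_{k,l}$ for every legal $X$ for which there is no $i\in[m]$ with $X=\hat\Gamma_F(i)$. *)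

(* Defs.v *)
From HB Require Import structures.
From mathcomp Require Import all_boot all_order all_algebra.
From mathcomp Require Import reals topology normedtype sequences.

Set Implicit Arguments.
Unset Strict Implicit.
Unset Printing Implicit Defensive.

Import Order.TTheory GRing.Theory Num.Theory.
Import numFieldNormedType.Exports.

(* A simple graph with vertex set T is its set of edges, each edge being an
   unordered pair of distinct vertices. *)
Record sgraph (T : finType) := SGraph {
  edges : {set {set T}};
  edges_card2 : [forall e in edges, #|e| == 2] }.

HB.instance Definition _ (T : finType) := [isSub for @edges T].
HB.instance Definition _ (T : finType) := [Finite of sgraph T by <:].

(* Never holds for x = y, since [set x; x] has cardinality 1. *)
Definition adj (T : finType) (G : sgraph T) : rel T :=
  fun x y => [set x; y] \in edges G.

(* The graph of the symmetric, loopless closure of r. *)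
Definition rel_edges (T : finType) (r : rel T) : {set {set T}} :=
  [set [set p.1; p.2] | p : T * T & (p.1 != p.2) && r p.1 p.2].

Lemma rel_edges_card2 (T : finType) (r : rel T) :
  [forall e in rel_edges r, #|e| == 2].
Proof.
apply/forallP => e; apply/implyP => /imsetP[[x y]].
by rewrite inE /= => /andP[xy _] ->; rewrite cards2 xy.
Qed.

Definition graph_of (T : finType) (r : rel T) : sgraph T :=
  SGraph (rel_edges_card2 r).
Definition complete_graph (T : finType) : sgraph T :=
  graph_of (fun _ _ => true).
Definition edgeless_graph (T : finType) : sgraph T :=
  graph_of (fun _ _ => false).

Definition clique (T : finType) (G : sgraph T) (A : {set T}) : bool :=
  [forall x in A, forall y in A, (x != y) ==> adj G x y].

Definition independent (T : finType) (G : sgraph T) (A : {set T}) : bool :=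
  [forall x in A, forall y in A, ~~ adj G x y].

Definition alpha (T : finType) (G : sgraph T) : nat :=
  \max_(A : {set T} | independent G A) #|A|.

(* P(K_k, G) *)
Definition num_cliques (T : finType) (k : nat) (G : sgraph T) : nat :=
  #|[set A : {set T} | clique G A & #|A| == k]|.

(* The subgraph of G induced by A contains H as an induced subgraph. *)
Definition contains_induced (S T : finType) (G : sgraph T) (A : {set T})
    (H : sgraph S) : Prop :=
  exists f : S -> T,
    [/\ injective f, forall x, f x \in A
      & forall x y, adj G (f x) (f y) = adj H x y].

(* V 0, ..., V (m - 1) are nonempty and pairwise disjoint with union T. *)
Definition vertex_partition (T : finType) (m : nat)
    (V : 'I_m -> {set T}) : Prop :=
  injective V /\ partition [set V i | i : 'I_m] [set: T].

Definition balanced (T : finType) (m : nat) (V : 'I_m -> {set T}) : Prop :=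
  forall i j, #|V i| <= #|V j| + 1.

(* F((V_1, ..., V_m)), for V_1, ..., V_m covering T. *)
Definition expansion (T : finType) (m : nat) (F : sgraph 'I_m)
    (V : 'I_m -> {set T}) : sgraph T :=
  graph_of (fun x y =>
    [exists i, exists j,
      [&& x \in V i, y \in V j & (i == j) || adj F i j]]).

(* For l >= 2 the complete graph is admissible, so this is a true minimum. *)
Definition f_min (n k l : nat) : nat :=
  num_cliques k
    [arg min_(G < complete_graph 'I_n | alpha G < l) num_cliques k G].

Local Open Scope ring_scope.

(* p(K_k, G) *)
Definition clique_density (R : realType) (T : finType) (k : nat)
    (G : sgraph T) : R :=
  (num_cliques k G)%:R / 'C(#|T|, k)%:R.

(* The quotient is 0 for n < k, which does not affect the limit. *)
Definition c_lim (R : realType) (k l : nat) : R :=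
  limn (fun n : nat => (f_min n k l)%:R / 'C(n, k)%:R : R).

Definition sym_diff (T : finType) (A B : {set T}) : {set T} :=
  (A :\: B) :|: (B :\: A).

Definition stability_graph (R : realType) (k l m : nat) (F : sgraph 'I_m) :
    Prop :=
  (alpha F < l)%N /\
  forall eps : R, 0 < eps ->
    exists (n0 : nat) (delta : R), 0 < delta /\
      forall (T : finType) (G : sgraph T),
        (n0 <= #|T|)%N -> (alpha G < l)%N ->
        clique_density R k G <= c_lim R k l + delta ->
        exists V : 'I_m -> {set T},
          [/\ vertex_partition V, balanced V &
            #|sym_diff (edges (expansion F V)) (edges G)|%:R
              <= eps * 'C(#|T|, 2)%:R].

Definition legal (l m : nat) (F : sgraph 'I_m) (X : {set 'I_m}) : Prop :=
  ~ contains_induced F (~: X) (edgeless_graph 'I_l.-1).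

(* Uniform probability on the m ^ (k - 1) sequences x_1, ..., x_{k-1}. *)
Definition grad (R : realType) (k m : nat) (F : sgraph 'I_m)
    (X : {set 'I_m}) : R :=
  #|[set x : {ffun 'I_k.-1 -> 'I_m} |
      [forall i, x i \in X] &&
      [forall i, forall j, adj F (x i) (x j) || (x i == x j)]]|%:R
  / #|{ffun 'I_k.-1 -> 'I_m}|%:R.

Definition closed_nbhd (m : nat) (F : sgraph 'I_m) (i : 'I_m) : {set 'I_m} :=
  i |: [set j | adj F i j].

Definition strict_stability_graph (R : realType) (k l m : nat)
    (F : sgraph 'I_m) : Prop :=
  stability_graph R k l F /\
  forall X : {set 'I_m}, legal l F X ->
    ~ (exists i : 'I_m, X = closed_nbhd F i) ->
    c_lim R k l < grad R k F X.

(* Main.v *)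
Require Import Defs.
From mathcomp Require Import all_boot all_order all_algebra reals.
From mathcomp Require Import topology normedtype sequences zify ring lra.

(* Deleting a vertex shows that f(n,k,l)/C(n,k) is nondecreasing, so it converges
   to c and f(n,k,l) <= c C(n,k). In an extremal G, replacing a vertex y by a
   clone of x shows that all vertices lie in nearly the same number of k-cliques,
   hence in at most (c + o(1)) C(n,k-1) of them.
   Stability gives a partition V_1, ..., V_m. For a vertex x let X(x) be the set
   of i such that x is joined to almost all of V_i. An independent transversal
   avoiding the neighbours of x shows that X(x) is legal, and counting cliques
   inside the neighbourhood of x gives grad X(x) <= c, so by strictness X(x) is a
   closed neighbourhood N[i] of F; put x in W_i. Balanced blowups of F show that
   the average of grad N[i] is at least c, so every grad N[i] equals c. Two
   consequences: x has few neighbours in V_t for t outside X(x), since these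
   would add cliques; and N[i] minus any j in it has gradient less than c, hence
   is not legal, i.e. j lies in an independent (l-1)-set whose other l-2 elements
   avoid N[i]. If x in W_i and y in W_j were nonadjacent, these l-2 classes would
   supply common non-neighbours completing {x, y} to an independent l-set. *)

Set Implicit Arguments.
Unset Strict Implicit.
Unset Printing Implicit Defensive.

(** * Graphs, blowups and the extremal number *)

Lemma adj_sym (T : finType) (G : sgraph T) x y : adj G x y = adj G y x.
Proof. by rewrite /adj setUC. Qed.

Lemma adj_irrefl (T : finType) (G : sgraph T) x : adj G x x = false.
Proof.
apply/negP => xx; have /forallP/(_ _)/implyP/(_ xx) := edges_card2 G.
by rewrite setUid cards1.
Qed.

Lemma eq_set2 (T : finType) (x y a b : T) :
  [set x; y] = [set a; b] -> (x = a /\ y = b) \/ (x = b /\ y = a).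
Proof.
move=> E; have /set2P[xE|xE] : x \in [set a; b] by rewrite -E set21.
  have /set2P[yE|] : y \in [set a; b]; [by rewrite -E set22| |by left].
  have /set2P[] : b \in [set x; y]; [by rewrite E set22| |];
    by rewrite xE yE => ->; left.
have /set2P[|yE] : y \in [set a; b]; [by rewrite -E set22|by right|].
have /set2P[] : a \in [set x; y]; [by rewrite E set21| |];
  by rewrite xE yE => ->; left.
Qed.

Lemma adj_graph_of (T : finType) (r : rel T) x y :
  adj (graph_of r) x y = (x != y) && (r x y || r y x).
Proof.
apply/imsetP/andP => [[[a b]]|[xy /orP[rxy|ryx]]].
- rewrite inE /= => /andP[ab rab] /eq_set2[[-> ->]|[-> ->]]; first by rewrite ab rab.
  by rewrite eq_sym ab rab orbT.
- by exists (x, y); rewrite // inE xy.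
- by exists (y, x); rewrite /= ?inE /= 1?setUC // eq_sym xy.
Qed.

Lemma edgeP (T : finType) (G : sgraph T) e :
  e \in edges G -> exists x y, e = [set x; y] /\ adj G x y.
Proof.
move=> eG; have /forallP/(_ _)/implyP/(_ eG) := edges_card2 G.
by case/cards2P=> x [y [_ E]]; exists x, y; rewrite /adj -E.
Qed.

Lemma independentP (T : finType) (G : sgraph T) (A : {set T}) :
  reflect {in A &, forall x y, ~~ adj G x y} (independent G A).
Proof.
apply: (iffP forall_inP) => [h x y xA yA|h x xA].
  by have /forall_inP := h x xA; apply.
by apply/forall_inP => y; apply: h.
Qed.

Lemma cliqueP (T : finType) (G : sgraph T) (A : {set T}) :
  reflect {in A &, forall x y, x != y -> adj G x y} (clique G A).
Proof.
apply: (iffP forall_inP) => [h x y xA yA|h x xA].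
  by have /forall_inP/(_ y yA)/implyP := h x xA.
by apply/forall_inP => y yA; apply/implyP; apply: h.
Qed.

Lemma independent_leq_alpha (T : finType) (G : sgraph T) (A : {set T}) :
  independent G A -> #|A| <= alpha G.
Proof. exact: leq_bigmax_cond. Qed.

(* Pulling G back along phi covers every modification of graphs in the proof:
   relabelling, vertex deletion, cloning a vertex and blowing F up. *)
Definition blowup (S T : finType) (phi : S -> T) (G : sgraph T) : sgraph S :=
  graph_of (fun x y => (phi x == phi y) || adj G (phi x) (phi y)).

Lemma adj_blowup (S T : finType) (phi : S -> T) (G : sgraph T) x y :
  adj (blowup phi G) x y =
    (x != y) && ((phi x == phi y) || adj G (phi x) (phi y)).
Proof. by rewrite adj_graph_of (eq_sym (phi y)) (adj_sym _ (phi y)) orbb. Qed.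

(** Fibres of [phi] become cliques, so [phi] is injective on an independent set and sends it to an
    independent set of [G]. *)
Lemma alpha_blowup (S T : finType) (phi : S -> T) (G : sgraph T) :
  alpha (blowup phi G) <= alpha G.
Proof.
apply/bigmax_leqP => A /independentP iA.
have injA : {in A &, injective phi}.
  move=> x y xA yA E; apply/eqP; apply: contraNT (iA x y xA yA) => xy.
  by rewrite adj_blowup xy E eqxx.
rewrite -(card_in_imset injA); apply: independent_leq_alpha; apply/independentP.
move=> _ _ /imsetP[x xA ->] /imsetP[y yA ->].
by apply: contra (iA x y xA yA) => a; rewrite adj_blowup a orbT andbT;
   apply: contraTneq a => ->; rewrite adj_irrefl.
Qed.

Lemma adj_blowup_inj (S T : finType) (phi : S -> T) (G : sgraph T) x y :
  injective phi -> adj (blowup phi G) x y = adj G (phi x) (phi y).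
Proof.
move=> inj; rewrite adj_blowup (inj_eq inj); case: eqVneq => //= ->.
by rewrite adj_irrefl.
Qed.

(** The condition on [codom phi] serves vertex deletion, where [phi] misses one vertex and only the
    cliques avoiding it survive. *)
Lemma num_cliques_blowup_leq (S T : finType) (phi : S -> T) (G : sgraph T) k :
  injective phi ->
  num_cliques k (blowup phi G)
    <= #|[set A : {set T} | clique G A & (#|A| == k) && (A \subset codom phi)]|.
Proof.
move=> inj; rewrite /num_cliques -(card_imset _ (imset_inj inj)); apply: subset_leq_card.
apply/subsetP => _ /imsetP[A + ->]; rewrite !inE card_imset // => /andP[cA ->].
apply/andP; split; last first.
  by apply/subsetP => _ /imsetP[x _ ->]; apply: codom_f.
apply/cliqueP => _ _ /imsetP[x xA ->] /imsetP[y yA ->]; rewrite (inj_eq inj) => xy.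
by rewrite -(adj_blowup_inj _ _ _ inj); apply: (elimT (cliqueP _ _) cA).
Qed.

Section ExtremalNumber.
Variables (k l : nat).
Hypothesis hl : 2 <= l.

Lemma alpha_complete_graph (T : finType) : alpha (complete_graph T) < l.
Proof.
apply: leq_trans hl; rewrite ltnS; apply/bigmax_leqP => A /independentP iA.
apply/card_le1_eqP => x y xA yA; apply/eqP; move: (iA _ _ yA xA).
by rewrite adj_graph_of andbT negbK.
Qed.

Lemma f_min_attained n :
  exists2 G : sgraph 'I_n, alpha G < l & num_cliques k G = f_min n k l.
Proof.
rewrite /f_min; case: arg_minnP => [|G aG _]; first exact: alpha_complete_graph.
by exists G.
Qed.

(** The minimum runs over graphs on ['I_n]; pulling [G] back along an enumeration of [T] transfers
    it to any vertex set. *)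
Lemma f_min_leq (T : finType) (G : sgraph T) :
  alpha G < l -> f_min #|T| k l <= num_cliques k G.
Proof.
move=> aG; have inj := @enum_val_inj T T.
have : alpha (blowup (@enum_val T T) G) < l.
  exact: leq_ltn_trans (alpha_blowup _ _) aG.
rewrite /f_min; case: arg_minnP => [|G0 _ /[apply]]; first exact: alpha_complete_graph.
move=> /leq_trans; apply; apply: leq_trans (num_cliques_blowup_leq _ _ inj) _.
by apply: subset_leq_card; apply/subsetP => A; rewrite !inE => /and3P[-> ->].
Qed.

(** Double counting of pairs (v, A) with v outside a k-clique A of an extremal graph on n + 1
    vertices: each deletion of a vertex leaves at least f(n,k,l) cliques, and each clique survives n
    + 1 - k deletions. *)
Lemma f_min_step n : n.+1 * f_min n k l <= (n.+1 - k) * f_min n.+1 k l.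
Proof.
have [G aG <-] := f_min_attained n.+1.
have del v : f_min n k l <= #|[set A in [set A | clique G A & #|A| == k] | v \notin A]|.
  have inj := @lift_inj n.+1 v.
  have := @f_min_leq _ (blowup (lift v) G) (leq_ltn_trans (alpha_blowup _ _) aG).
  rewrite card_ord => /leq_trans; apply.
  apply: leq_trans (num_cliques_blowup_leq _ _ inj) _.
  apply: subset_leq_card; apply/subsetP => A; rewrite !inE => /and3P[-> -> /= /subsetP sA].
  apply/negP => /sA /codomP[j /eqP]; apply/negP; exact: neq_lift.
rewrite -[X in X * _](card_ord n.+1) -sum_nat_const.
apply: leq_trans (leq_sum _ (fun v _ => del v)) _.
under eq_bigr do rewrite -sum1dep_card big_mkcondr /=.
rewrite exchange_big /= /num_cliques mulnC -sum_nat_const.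
apply: leq_sum => A; rewrite inE => /andP[_ /eqP <-].
rewrite -big_mkcond sum1dep_card -[X in _ <= X - _]card_ord -(cardsC A) addKn.
by apply/eq_leq/eq_card => v; rewrite !inE.
Qed.

End ExtremalNumber.

(** Each q-set has q! injective enumerations. This lets cliques be counted as sequences, whose
    counts are products over the coordinates. *)
Lemma card_inj_seqs (T : finType) q (P : pred {set T}) :
  #|[set s : {ffun 'I_q -> T} | injectiveb s && P [set s i | i : 'I_q]]|
    = q`! * #|[set A : {set T} | P A & #|A| == q]|.
Proof.
pose im (s : {ffun 'I_q -> T}) : {set T} := [set s i | i : 'I_q].
rewrite -sum1_card (partition_big im [in [set A | P A & #|A| == q]]) /=; last first.
  move=> s; rewrite !inE => /andP[/injectiveP inj ->] /=.
  by rewrite card_imset // card_ord.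
rewrite mulnC -sum_nat_const; apply: eq_bigr => A; rewrite inE => /andP[PA /eqP cA].
have -> : q`! = #|[set f in ffun_on (mem A) | injectiveb (f : {ffun 'I_q -> T})]|.
  by rewrite card_inj_ffuns_on card_ord cA ffactnn.
rewrite sum1dep_card; apply: eq_card => s; rewrite !inE.
apply/andP/andP => [[/andP[inj _] /eqP <-]|[/ffun_onP sA inj]].
  by split=> //; apply/ffun_onP => i; apply: imset_f.
have E : im s = A.
  apply/eqP; rewrite eqEcard card_imset; last exact/injectiveP.
  by rewrite card_ord cA leqnn andbT; apply/subsetP => _ /imsetP[i _ ->].
by rewrite inj -/(im s) E.
Qed.

Lemma card_box (I T : finType) (A : I -> {set T}) :
  #|[set s : {ffun I -> T} | [forall i, s i \in A i]]| = \prod_i #|A i|.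
Proof.
rewrite cardsE (card_family (fun i => mem (A i))) foldrE big_map big_enum.
by [].
Qed.

(** * Cloning a vertex *)

Definition num_cliques_at (T : finType) k (G : sgraph T) (x : T) : nat :=
  #|[set A in [set A : {set T} | clique G A & #|A| == k] | x \in A]|.

Lemma sum_num_cliques_at (T : finType) k (G : sgraph T) :
  \sum_x num_cliques_at k G x = k * num_cliques k G.
Proof.
under eq_bigr do rewrite /num_cliques_at -sum1dep_card big_mkcondr /=.
rewrite exchange_big /= /num_cliques mulnC -sum_nat_const.
apply: eq_bigr => A; rewrite inE => /andP[_ /eqP <-].
by rewrite -big_mkcond sum1dep_card; apply: eq_card => v; rewrite !inE.
Qed.

Lemma card_sets_through (T : finType) k (x y : T) : 2 <= k -> x != y ->
  #|[set A : {set T} | (#|A| == k) && ([set x; y] \subset A)]|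
    <= 'C(#|T| - 2, k - 2).
Proof.
move=> hk xy.
have c2 : #|[set x; y]| = 2 by rewrite cards2 xy.
have -> : #|T| - 2 = #|~: [set x; y]| by rewrite -(cardsC [set x; y]) c2 addKn.
rewrite -cards_draws.
pose D (A : {set T}) := A :\: [set x; y].
rewrite -(@card_in_imset _ _ D); last first.
  move=> A B; rewrite !inE => /andP[_ sA] /andP[_ sB] E.
  rewrite -(setID A [set x; y]) -(setID B [set x; y]) (setIidPr sA) (setIidPr sB).
  by rewrite -/(D A) -/(D B) E.
apply: subset_leq_card; apply/subsetP => _ /imsetP[A + ->]; rewrite inE => /andP[/eqP cA sA].
by rewrite inE {1}/D setDE subsetIr cardsD (setIidPr sA) c2 cA /=.
Qed.

(** Pulling [G] back along [redirect x y], for x distinct from y, turns y into a clone of x that is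
    adjacent to x. *)
Definition redirect (T : eqType) (x y v : T) : T := if v == y then x else v.

(** Cliques of the new graph avoiding y are cliques of [G] avoiding y. Those containing y but not x
    inject into the cliques of [G] at x by replacing y with x. Those containing both are bounded by
    the number of all k-sets through x and y. *)
Lemma clone_num_cliques (T : finType) k (G : sgraph T) (x y : T) :
  2 <= k -> x != y ->
  num_cliques k (blowup (redirect x y) G) + num_cliques_at k G y
    <= num_cliques k G + num_cliques_at k G x + 'C(#|T| - 2, k - 2).
Proof.
move=> hk xy; set G' := blowup _ G.
pose C (H : sgraph T) := [set A : {set T} | clique H A & #|A| == k].
have splitC (H : sgraph T) z (D : {set {set T}}) :
    #|D| = #|[set A in D | z \in A]| + #|[set A in D | z \notin A]|.
  rewrite -(cardsID [set A : {set T} | z \in A] D); congr (_ + _);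
  by apply: eq_card => A; rewrite !inE // andbC.
have redirect_id v : v != y -> redirect x y v = v by rewrite /redirect => /negPf->.
have off_y : #|[set A in C G' | y \notin A]| <= #|[set A in C G | y \notin A]|.
  apply: subset_leq_card; apply/subsetP => A; rewrite !inE => /andP[/andP[/cliqueP cA ->] yA].
  rewrite yA !andbT; apply/cliqueP => u v uA vA uv.
  have uy : u != y by apply: contraNneq yA => <-.
  have vy : v != y by apply: contraNneq yA => <-.
  by have := cA u v uA vA uv; rewrite adj_blowup !redirect_id // (negPf uv).
have only_y : #|[set A in [set A in C G' | y \in A] | x \notin A]|
    <= num_cliques_at k G x.
  have injA (A : {set T}) : x \notin A -> {in A &, injective (redirect x y)}.
    move=> xA u v uA vA; rewrite /redirect.
    case: eqVneq => [->|uy]; case: eqVneq => [->|vy] // E.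
      by rewrite E vA in xA.
    by rewrite -E uA in xA.
  rewrite -(@card_in_imset _ _ (fun A : {set T} => redirect x y @: A)); last first.
    have back (A : {set T}) : x \notin A -> y \in A ->
        A = redirect y x @: (redirect x y @: A).
      move=> xA yA; rewrite -imset_comp -[LHS]imset_id; apply: eq_in_imset => v vA /=.
      rewrite /redirect; case: (eqVneq v y) => [->|vy]; first by rewrite eqxx.
      by case: eqVneq vA xA => // -> ->.
    move=> A B; rewrite !inE => /andP[/andP[_ yA] xA] /andP[/andP[_ yB] xB] E.
    by rewrite (back A) // (back B) // E.
  apply: subset_leq_card; apply/subsetP => _ /imsetP[A + ->].
  rewrite !inE => /andP[/andP[/andP[/cliqueP cA kA] yA] xA].
  rewrite card_in_imset; last exact: injA.
  rewrite kA andbT; apply/andP; split; last first.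
    by apply/imsetP; exists y; rewrite // /redirect eqxx.
  apply/cliqueP => _ _ /imsetP[u uA ->] /imsetP[v vA ->] uv.
  have : u != v by apply: contraNneq uv => ->.
  by move/(cA u v uA vA); rewrite adj_blowup (negPf uv) => /andP[].
have both : #|[set A in [set A in C G' | y \in A] | x \in A]| <= 'C(#|T| - 2, k - 2).
  apply: leq_trans (card_sets_through hk xy); apply: subset_leq_card.
  apply/subsetP => A; rewrite !inE => /andP[/andP[/andP[_ ->] yA] xA].
  by apply/subsetP => v /set2P[] ->.
rewrite /num_cliques -/(C G') -/(C G) (splitC G' y (C G')) (splitC G y (C G)).
rewrite (splitC G' x [set A in C G' | y \in A]).
rewrite /num_cliques_at -/(C G) in only_y *; move: off_y both only_y; clear.
by do 7!move: #|_| => ?; lia.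
Qed.

(** Turning y into a clone of x keeps the independence number below l, so by extremality it cannot
    lower the number of cliques. *)
Lemma num_cliques_at_leq (T : finType) k l (G : sgraph T) (x y : T) :
  2 <= k -> 2 <= l -> alpha G < l -> num_cliques k G = f_min #|T| k l ->
  num_cliques_at k G y <= num_cliques_at k G x + 'C(#|T| - 2, k - 2).
Proof.
move=> hk hl aG ext; have [->|xy] := eqVneq x y; first exact: leq_addr.
have := clone_num_cliques G hk xy.
have := @f_min_leq k l hl _ (blowup (redirect x y) G) (leq_ltn_trans (alpha_blowup _ _) aG).
rewrite -ext; lia.
Qed.

(** As [adj] is irreflexive, such sequences are injective: they are the ordered q-cliques in the
    neighbourhood of x. *)
Definition nbr_seqs (T : finType) q (G : sgraph T) (x : T) : {set {ffun 'I_q -> T}} :=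
  [set s : {ffun 'I_q -> T} | [forall i, adj G x (s i)] &&
    [forall i, forall j, (i != j) ==> adj G (s i) (s j)]].

Lemma card_nbr_seqs (T : finType) q (G : sgraph T) (x : T) :
  #|nbr_seqs q G x| <= q`! * num_cliques_at q.+1 G x.
Proof.
pose P (A : {set T}) := clique G A && (A \subset [set z | adj G x z]).
apply: (@leq_trans (q`! * #|[set A | P A & #|A| == q]|)).
  rewrite -card_inj_seqs; apply: subset_leq_card; apply/subsetP => s; rewrite !inE.
  move=> /andP[/forallP xs /forallP ss].
  have {}ss i j : i != j -> adj G (s i) (s j) by have /forallP/(_ j)/implyP := ss i.
  apply/andP; split.
    apply/injectiveP => i j E; apply/eqP; apply: contraT => /ss.
    by rewrite E adj_irrefl.
  apply/andP; split; last by apply/subsetP => _ /imsetP[i _ ->]; rewrite inE.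
  apply/cliqueP => _ _ /imsetP[i _ ->] /imsetP[j _ ->] ij.
  by apply: ss; apply: contraNneq ij => ->.
rewrite leq_mul2l; apply/orP; right.
have xP A : P A -> x \notin A.
  move=> /andP[_ /subsetP sA]; apply/negP => /sA; rewrite inE.
  by rewrite adj_irrefl.
rewrite -(@card_in_imset _ _ (fun A => x |: A)); last first.
  move=> A B; rewrite !inE => /andP[/xP xA _] /andP[/xP xB _] E.
  by rewrite -(setU1K xA) -(setU1K xB) E.
apply: subset_leq_card; apply/subsetP => _ /imsetP[A + ->].
rewrite !inE => /andP[PA /eqP cA]; rewrite cardsU1 xP // cA add1n !eqxx /= !andbT.
have /andP[/cliqueP clA /subsetP sA] := PA.
apply/cliqueP => u v /setU1P[->|uA] /setU1P[->|vA].
- by rewrite eqxx.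
- by have := sA v vA; rewrite inE.
- by have := sA u uA; rewrite inE adj_sym.
- exact: clA.
Qed.

(** * Counting sequences *)

(** A union bound, with the factor [a] kept on the left so that probabilities can be handled in
    [nat] without division. *)
Lemma card_exists_leq (I S : finType) (P : I -> pred S) a M :
  (forall i, #|[set s | P i s]| * a <= M) ->
  #|[set s | [exists i, P i s]]| * a <= #|I| * M.
Proof.
move=> h; apply: (@leq_trans ((\sum_i #|[set s | P i s]|) * a)); last first.
  by rewrite big_distrl -sum_nat_const; apply: leq_sum => i _; apply: h.
rewrite leq_mul2r; apply/orP; right.
under eq_bigr do rewrite -sum1dep_card big_mkcond /=.
rewrite exchange_big /= -sum1dep_card big_mkcond; apply: leq_sum => s _.
by case: existsP => // -[i Pi]; rewrite (bigD1 i) //= Pi.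
Qed.

Lemma card_exists_hit (T : finType) r (C : {set T}) :
  #|[set s : {ffun 'I_r -> T} | [exists i, s i \in C]]| * #|T|
    <= r * (#|C| * #|T| ^ r).
Proof.
have cF : #|{ffun 'I_r -> T}| = #|T| ^ r by rewrite card_ffun card_ord.
rewrite -[X in _ <= X * _]card_ord; apply: card_exists_leq => i.
rewrite -cF -!cardsT -!cardsX.
(* Writing u into coordinate i while keeping the old value, which lies in [C], loses no information
   about (s, u). *)
pose h (p : {ffun 'I_r -> T} * T) := (p.1 i, [ffun a => if a == i then p.2 else p.1 a]).
rewrite -(@card_in_imset _ _ h) => [|[s u] [t v] _ _ [E /ffunP E']].
  apply: subset_leq_card; apply/subsetP => _ /imsetP[[s u] + ->].
  by rewrite !inE andbT.
have := E' i; rewrite !ffunE eqxx /= => ->; congr (_, _).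
apply/ffunP => a; have := E' a; rewrite !ffunE /=.
by case: eqVneq => [->|].
Qed.

Lemma card_exists_pair_hit (T : finType) r (B : {set T * T}) :
  #|[set s : {ffun 'I_r -> T} |
      [exists i, exists j, (i != j) && ((s i, s j) \in B)]]| * #|T| ^ 2
    <= r ^ 2 * (#|B| * #|T| ^ r).
Proof.
have cF : #|{ffun 'I_r -> T}| = #|T| ^ r by rewrite card_ffun card_ord.
rewrite -!mulnn -(mulnA r) -[X in _ <= X * _]card_ord; apply: card_exists_leq => i.
rewrite -[X in _ <= X * _]card_ord; apply: card_exists_leq => j.
have [->|ij] := eqVneq i j.
  by rewrite eq_card0 // => s; rewrite !inE.
rewrite -card_prod -cF -!cardsT -!cardsX.
(* The same exchange in two coordinates: the old pair, an element of [B], is kept and two free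
   values take its place. *)
pose h (p : {ffun 'I_r -> T} * (T * T)) := ((p.1 i, p.1 j),
  [ffun a => if a == i then p.2.1 else if a == j then p.2.2 else p.1 a]).
rewrite -(@card_in_imset _ _ h) => [|[s [u1 u2]] [t [v1 v2]] _ _ [Ei Ej /ffunP E]].
  apply: subset_leq_card; apply/subsetP => _ /imsetP[[s [u v]] + ->].
  by rewrite !inE !andbT.
have := E i; have := E j; rewrite !ffunE !eqxx eq_sym (negPf ij) /= => -> ->.
congr (_, _); apply/ffunP => a; have := E a; rewrite !ffunE /=.
by case: eqVneq => [->|_] //; case: eqVneq => [->|_].
Qed.

Section RingScope.
Import Order.TTheory GRing.Theory Num.Theory.
Local Open Scope ring_scope.

(** * The limit density *)

Lemma bernoulli_ler (R : realFieldType) (x : R) q :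
  0 <= x <= 1 -> 1 - q%:R * x <= (1 - x) ^+ q.
Proof.
move=> /andP[x0 x1]; elim: q => [|q IH]; first by rewrite mul0r subr0.
rewrite exprS; have : (1 - x) * (1 - q%:R * x) <= (1 - x) * (1 - x) ^+ q.
  by rewrite ler_wpM2l ?subr_ge0.
apply: le_trans; rewrite -natr1.
have : 0 <= q%:R * x * x by rewrite !mulr_ge0.
lra.
Qed.

Lemma ffact_ler (R : realFieldType) (n k : nat) : (k <= n)%N -> (0 < n)%N ->
  (1 - k%:R / n%:R) ^+ k * n%:R ^+ k <= (n ^_ k)%:R :> R.
Proof.
move=> kn n0; rewrite -exprMn mulrBl mul1r divfK ?pnatr_eq0 -?lt0n // -natrB //.
rewrite -natrX ler_nat.
suff: forall j, (j <= k)%N -> ((n - k) ^ j <= n ^_ j)%N by apply.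
by elim=> // j IH jk; rewrite ffactnSr expnSr leq_mul //; [apply: IH; lia|lia].
Qed.

Section Limit.
Variables (R : realType) (k l : nat).
Hypothesis hl : (2 <= l)%N.

Let dens (n : nat) : R := (f_min n k l)%:R / 'C(n, k)%:R.

Lemma f_min_le_bin n : (f_min n k l <= 'C(n, k))%N.
Proof.
have [G _ <-] := f_min_attained k hl n.
rewrite -[X in (_ <= 'C(X, _))%N]card_ord -card_draws.
by apply: subset_leq_card; apply/subsetP => A; rewrite !inE => /andP[].
Qed.

Lemma dens_le1 n : dens n <= 1.
Proof.
rewrite /dens; case: (posnP 'C(n, k)) => [->|C0]; first by rewrite invr0 mulr0.
by rewrite ler_pdivrMr ?ltr0n // mul1r ler_nat f_min_le_bin.
Qed.

Lemma dens_nondecreasing : {homo dens : n m / (n <= m)%N >-> n <= m}.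
Proof.
apply: homo_leq => [n|a b c|n]; [exact: lexx|exact: le_trans|].
(* For n < k the binomial coefficient is 0, and division by zero makes the density 0. *)
rewrite /dens; have [nk|kn] := ltnP n k.
  by rewrite (bin_small nk) invr0 mulr0 divr_ge0.
have Cn : (0 < 'C(n, k))%N by rewrite bin_gt0.
have CSn : (0 < 'C(n.+1, k))%N by rewrite bin_gt0 leqW.
rewrite ler_pdivrMr ?ltr0n // mulrAC ler_pdivlMr ?ltr0n // -!natrM ler_nat.
have := f_min_step k hl n; have := mul_bin_down n.+1 k => /=.
move: (f_min _ _ _) (f_min _ _ _) 'C(n, k) 'C(n.+1, k) => a b c d E h.
rewrite -(@leq_pmul2l n.+1) // mulnA; apply: leq_trans (leq_mul h (leqnn d)) _.
by apply/eq_leq; rewrite [RHS]mulnCA E; lia.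
Qed.

Lemma dens_le_c_lim n : dens n <= c_lim R k l.
Proof.
apply: (@nondecreasing_cvgn_le R dens); first exact: dens_nondecreasing.
apply: nondecreasing_is_cvgn; first exact: dens_nondecreasing.
by exists 1 => _ [i _ <-]; exact: dens_le1.
Qed.

Lemma c_lim_le_of_dens (M : R) : (forall n, dens n <= M) -> c_lim R k l <= M.
Proof.
move=> h; apply: limr_le; last by apply: nearW => n; exact: h.
apply: nondecreasing_is_cvgn; first exact: dens_nondecreasing.
by exists 1 => _ [i _ <-]; exact: dens_le1.
Qed.

Lemma c_lim_ge0 : 0 <= c_lim R k l.
Proof. exact: le_trans (divr_ge0 (ler0n _ _) (ler0n _ _)) (dens_le_c_lim 0). Qed.

Lemma f_min_le_c_lim n : (f_min n k l)%:R <= c_lim R k l * 'C(n, k)%:R.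
Proof.
have := dens_le_c_lim n; rewrite /dens; case: (posnP 'C(n, k)) => [C0 _|C0].
  by have := f_min_le_bin n; rewrite C0 mulr0 leqn0 => /eqP->.
by rewrite ler_pdivrMr ?ltr0n.
Qed.

End Limit.

(** Entries may repeat because several vertices of a clique can lie in one class of a blowup.
    Divided by m^k, this count is the limiting k-clique density of the balanced blowups of [F]. *)
Definition clique_seqs (k m : nat) (F : sgraph 'I_m) : {set {ffun 'I_k -> 'I_m}} :=
  [set x : {ffun 'I_k -> 'I_m} |
    [forall i, forall j, adj F (x i) (x j) || (x i == x j)]].

(** An ordered clique splits into its sequence of classes, which is a clique sequence of [F], and
    its sequence of positions inside the classes, for which there are at most N^k choices. *)
Lemma num_cliques_blowup_fst (k m N : nat) (F : sgraph 'I_m) :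
  (k`! * num_cliques k (blowup (fst : 'I_m * 'I_N -> 'I_m) F)
    <= #|clique_seqs k F| * N ^ k)%N.
Proof.
rewrite -card_inj_seqs.
have <- : #|[set: {ffun 'I_k -> 'I_N}]| = (N ^ k)%N.
  by rewrite cardsT card_ffun !card_ord.
rewrite -cardsX.
pose h (s : {ffun 'I_k -> 'I_m * 'I_N}) := ([ffun i => (s i).1], [ffun i => (s i).2]).
have injh : injective h.
  move=> s t [/ffunP E1 /ffunP E2]; apply/ffunP => i.
  by have := E1 i; have := E2 i; rewrite !ffunE; case: (s i) (t i) => ? ? [? ?] /= -> ->.
rewrite -(card_imset _ injh); apply: subset_leq_card.
apply/subsetP => _ /imsetP[s + ->]; rewrite !inE andbT => /andP[/injectiveP inj /cliqueP cs].
apply/forallP => i; apply/forallP => j; rewrite !ffunE.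
have [->|ij] := eqVneq i j; first by rewrite eqxx orbT.
have := cs (s i) (s j) (imset_f _ isT) (imset_f _ isT); rewrite (inj_eq inj) => /(_ ij).
by rewrite adj_blowup => /andP[_]; rewrite orbC.
Qed.

(** Balanced blowups of [F] are admissible in the definition of f. Since the densities are
    nondecreasing, one large blowup bounds the density at n up to an error [e]. *)
Lemma c_lim_le_blowup (R : realType) (k l m : nat) (F : sgraph 'I_m) :
  (2 <= l)%N -> (0 < m)%N -> (alpha F < l)%N ->
  c_lim R k l <= #|clique_seqs k F|%:R / m%:R ^+ k.
Proof.
move=> hl m0 aF; apply: c_lim_le_of_dens => // n.
apply/ler_addgt0Pr => e e0.
set S := #|_|.
(* The last summand makes N > k^2 / e, so the Bernoulli loss k * (k / p) in passing from the falling
   factorial to p^k is at most [e]. *)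
pose N := (n + k + (Num.truncn (k%:R ^+ 2 / e)).+1)%N.
have Ne : k%:R ^+ 2 / e < N%:R.
  apply: lt_le_trans (truncnS_gt _) _; by rewrite ler_nat leq_addl.
have N0 : (0 < N)%N by rewrite /N addnS.
pose p := (m * N)%N.
have p0 : (0 < p)%N by rewrite muln_gt0 m0.
have pN : (N <= p)%N by rewrite leq_pmull.
have kp : (k <= p)%N by apply: leq_trans pN; rewrite /N; lia.
have np : (n <= p)%N by apply: leq_trans pN; rewrite /N; lia.
apply: le_trans (dens_nondecreasing R k hl np) _.
have := dens_le1 R k hl p; set u := _ / _ => u1.
have u0 : 0 <= u by rewrite divr_ge0.
have C0 : (0 < 'C(p, k))%N by rewrite bin_gt0.
have h1 : u * (p ^_ k)%:R <= S%:R * N%:R ^+ k.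
  rewrite -bin_ffact natrM mulrA divfK ?pnatr_eq0 -?lt0n //.
  rewrite -natrX -!natrM ler_nat mulnC.
  apply: leq_trans (num_cliques_blowup_fst k N F); rewrite leq_mul2l; apply/orP; right.
  have := @f_min_leq k l hl _ (blowup (fst : 'I_m * 'I_N -> 'I_m) F).
  rewrite card_prod !card_ord; apply.
  exact: leq_ltn_trans (alpha_blowup _ _) aF.
have h2 : u * ((1 - k%:R / p%:R) ^+ k * p%:R ^+ k) <= S%:R * N%:R ^+ k.
  apply: le_trans h1; rewrite ler_wpM2l //; exact: ffact_ler.
have pR : 0 < p%:R :> R by rewrite ltr0n.
have kpR : 0 <= (k%:R / p%:R : R) <= 1.
  by rewrite divr_ge0 //= ler_pdivrMr // mul1r ler_nat.
have h3 : u * (1 - k%:R / p%:R) ^+ k <= S%:R / m%:R ^+ k.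
  rewrite ler_pdivlMr ?exprn_gt0 ?ltr0n //.
  rewrite -(@ler_pM2r _ (N%:R ^+ k)) ?exprn_gt0 ?ltr0n //.
  by rewrite -[leLHS]mulrA -exprMn -natrM -mulrA.
have h4 := bernoulli_ler k kpR.
have h5 : k%:R * (k%:R / p%:R) <= e.
  rewrite mulrA -expr2 ler_pdivrMr // mulrC -ler_pdivrMr //.
  by apply: le_trans (ltW Ne) _; rewrite ler_nat.
have h6 : u * (1 - k%:R * (k%:R / p%:R)) <= S%:R / m%:R ^+ k.
  by apply: le_trans h3; rewrite ler_wpM2l.
have : u * (k%:R * (k%:R / p%:R)) <= 1 * e.
  by rewrite ler_pM // mulr_ge0 // divr_ge0.
lra.
Qed.

(** Summing [num_cliques_at_leq] over all y compares x with the average (q + 1) f / n, which f <= c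
    C(n, q + 1) bounds. The cloning error contributes at most q n^(q-1) sequences, hence the term q
    / n. *)
Lemma card_nbr_seqs_leq (R : realType) q l (T : finType) (G : sgraph T) (x : T) :
  (1 <= q)%N -> (2 <= l)%N -> (alpha G < l)%N ->
  num_cliques q.+1 G = f_min #|T| q.+1 l ->
  #|nbr_seqs q G x|%:R
    <= (c_lim R q.+1 l + q%:R / #|T|%:R) * #|T|%:R ^+ q.
Proof.
move=> hq hl aG ext; set n := #|T|.
have n0 : (0 < n)%N by apply/card_gt0P; exists x.
have nR : 0 < n%:R :> R by rewrite ltr0n.
have h1 : (n * num_cliques_at q.+1 G x
    <= q.+1 * f_min n q.+1 l + n * 'C(n - 2, q.+1 - 2))%N.
  rewrite -ext -sum_num_cliques_at -!sum_nat_const -big_split /=.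
  by apply: leq_sum => y _; exact: (@num_cliques_at_leq _ q.+1 l G y x hq hl aG ext).
have h2 := card_nbr_seqs q G x.
have h3 : (n * #|nbr_seqs q G x| <=
    q.+1`! * f_min n q.+1 l + n * (q`! * 'C(n - 2, q.+1 - 2)))%N.
  apply: leq_trans (leq_mul (leqnn n) h2) _.
  rewrite mulnCA (mulnCA n q`!) factS -mulnA (mulnCA q.+1) -mulnDr.
  by rewrite leq_mul2l h1 orbT.
have ffact_expn a b : (a <= n)%N -> (a ^_ b <= n ^ b)%N.
  move=> an; elim: b => // b IH; rewrite ffactnSr expnSr leq_mul //; lia.
have h4 : (q`! * 'C(n - 2, q.+1 - 2) <= q * n ^ q.-1)%N.
  case: (q) hq => // r _; rewrite (_ : r.+2 - 2 = r)%N; last lia.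
  rewrite factS -mulnA leq_mul2l mulnC bin_ffact /=.
  by apply: ffact_expn; rewrite leq_subr.
have h5 : (q.+1`!)%:R * (f_min n q.+1 l)%:R <= c_lim R q.+1 l * n%:R ^+ q.+1.
  have c0 := c_lim_ge0 R q.+1 hl.
  apply: (@le_trans _ _ ((q.+1`!)%:R * (c_lim R q.+1 l * 'C(n, q.+1)%:R))).
    by rewrite ler_wpM2l //; exact: f_min_le_c_lim.
  rewrite mulrCA ler_wpM2l // -natrM -natrX ler_nat mulnC bin_ffact.
  exact: ffact_expn.
rewrite -(ler_pM2l nR).
apply: (@le_trans _ _ (c_lim R q.+1 l * n%:R ^+ q.+1 + n%:R * (q%:R * n%:R ^+ q.-1))).
  rewrite -natrM; apply: (@le_trans _ _ (q.+1`! * f_min n q.+1 l + n * (q * n ^ q.-1))%:R).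
    by rewrite ler_nat; apply: leq_trans h3 _; rewrite leq_add2l leq_mul2l h4 orbT.
  by rewrite natrD lerD ?natrM ?natrX // (le_trans _ h5) // natrM.
rewrite le_eqVlt; apply/orP; left; apply/eqP.
case: (q) hq => // r _; rewrite /= !exprS; field.
by rewrite pnatr_eq0 -lt0n.
Qed.

(** * Graphs close to an expansion *)

Lemma in_closed_nbhd (m : nat) (F : sgraph 'I_m) i j :
  (j \in closed_nbhd F i) = (i == j) || adj F i j.
Proof. by rewrite /closed_nbhd !inE eq_sym. Qed.

Lemma closed_nbhd_sym (m : nat) (F : sgraph 'I_m) i j :
  (j \in closed_nbhd F i) = (i \in closed_nbhd F j).
Proof. by rewrite !in_closed_nbhd eq_sym adj_sym. Qed.

Section Approximation.
Variables (R : realType) (T : finType) (G : sgraph T) (m : nat) (F : sgraph 'I_m).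
Variable phi : T -> 'I_m.
Notation n := (#|T|%:R : R).
Hypothesis n0 : 0 < n.

(* Pairs on which G differs from the expansion of F along phi, loops (x, x) included. *)
Definition bad_pairs : {set T * T} :=
  [set p | adj G p.1 p.2 != (phi p.2 \in closed_nbhd F (phi p.1))].

Variable eta : R.
Hypothesis bad_leq : #|bad_pairs|%:R <= eta * n ^+ 2.

Lemma hit_ler r (C : {set T}) g : #|C|%:R <= g * n ->
  #|[set s : {ffun 'I_r -> T} | [exists i, s i \in C]]|%:R <= r%:R * g * n ^+ r.
Proof.
move=> Cg; rewrite -(ler_pM2r n0) -natrM.
apply: (@le_trans _ _ (r * (#|C| * #|T| ^ r))%:R).
  by rewrite ler_nat; exact: card_exists_hit.
rewrite !natrM natrX (_ : r%:R * g * n ^+ r * n = r%:R * (g * n * n ^+ r)); last by ring.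
by rewrite ler_wpM2l // ler_wpM2r // exprn_ge0 // ltW.
Qed.

(** All loops are in [bad_pairs], so equal indices must be excluded. Equal entries at distinct
    indices do count as bad, so a sequence without a bad pair is injective. *)
Definition has_bad_pair r (s : {ffun 'I_r -> T}) :=
  [exists i, exists j, (i != j) && ((s i, s j) \in bad_pairs)].

Lemma has_bad_pair_ler r :
  #|[set s : {ffun 'I_r -> T} | has_bad_pair s]|%:R <= r%:R ^+ 2 * eta * n ^+ r.
Proof.
have n20 : 0 < n ^+ 2 by rewrite exprn_gt0.
rewrite -(ler_pM2r n20).
apply: (@le_trans _ _ (r ^ 2 * (#|bad_pairs| * #|T| ^ r))%:R).
  by rewrite -natrX -natrM ler_nat; exact: card_exists_pair_hit.
rewrite natrM natrX natrM natrX.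
rewrite (_ : r%:R ^+ 2 * eta * n ^+ r * n ^+ 2 = r%:R ^+ 2 * (eta * n ^+ 2 * n ^+ r)); last by ring.
by rewrite ler_wpM2l ?exprn_ge0 // ler_wpM2r // exprn_ge0 // ltW.
Qed.

Lemma not_has_bad_pair r (s : {ffun 'I_r -> T}) i j : ~~ has_bad_pair s -> i != j ->
  adj G (s i) (s j) = (phi (s j) \in closed_nbhd F (phi (s i))).
Proof.
move=> /existsPn/(_ i)/existsPn/(_ j); rewrite negb_and negbK => /orP[/eqP->|].
  by rewrite eqxx.
by rewrite inE negbK => /eqP.
Qed.

(** The box of the sets [A i] has at least (a n)^r sequences, more than have a bad pair. A sequence
    of the box without one behaves as in the expansion, where the classes [f i] are pairwise
    nonadjacent. *)
Lemma independent_transversal r (f : 'I_r -> 'I_m) (A : 'I_r -> {set T}) (a : R) :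
  (forall i j, i != j -> f j \notin closed_nbhd F (f i)) ->
  (forall i u, u \in A i -> phi u = f i) ->
  0 <= a -> r%:R ^+ 2 * eta < a ^+ r -> (forall i, a * n <= #|A i|%:R) ->
  exists s : {ffun 'I_r -> T},
    (forall i, s i \in A i) /\ (forall i j, i != j -> ~~ adj G (s i) (s j)).
Proof.
move=> fI Af a0 ra Aa.
pose box := [set s : {ffun 'I_r -> T} | [forall i, s i \in A i]].
have : ~~ (box \subset [set s | has_bad_pair s]).
  apply/negP => /subset_leq_card; rewrite -(ler_nat R) card_box => h.
  have := le_trans h (has_bad_pair_ler r); apply/negP; rewrite -ltNge.
  apply: (@lt_le_trans _ _ (a ^+ r * n ^+ r)).
    by rewrite ltr_pM2r // exprn_gt0.
  rewrite -exprMn natr_prod -[r in _ ^+ r]card_ord -prodr_const.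
  by apply: ler_prod => i _; rewrite Aa mulr_ge0 // ltW.
case/subsetPn => s; rewrite !inE => /forallP sA nb; exists s; split => // i j ij.
by rewrite (not_has_bad_pair nb ij) (Af _ _ (sA i)) (Af _ _ (sA j)) fI.
Qed.

(** A sequence of [S] that avoids [C] and has no bad pair is an ordered clique in the neighbourhood
    of x; union bounds cover the exceptions. *)
Lemma nbr_seqs_ler q (x : T) (S : {set {ffun 'I_q -> T}}) (C : {set T}) (g : R) :
  #|C|%:R <= g * n ->
  (forall s, s \in S -> forall i, (s i \in C) || adj G x (s i)) ->
  (forall s, s \in S -> forall i j, phi (s j) \in closed_nbhd F (phi (s i))) ->
  #|S|%:R <= #|nbr_seqs q G x|%:R + (q%:R * g + q%:R ^+ 2 * eta) * n ^+ q.
Proof.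
move=> Cg SC SF.
have sub : S \subset nbr_seqs q G x :|: [set s : {ffun 'I_q -> T} | [exists i, s i \in C]]
    :|: [set s : {ffun 'I_q -> T} | has_bad_pair s].
  apply/subsetP => s sS; rewrite !inE.
  have [//|nb] := boolP (has_bad_pair s); first by rewrite orbT.
  have [//|/existsPn nC] := boolP [exists i, s i \in C]; first by rewrite orbT.
  rewrite !orbF; apply/andP; split.
    by apply/forallP => i; have := SC s sS i; rewrite (negPf (nC i)).
  apply/forallP => i; apply/forallP => j; apply/implyP => ij.
  by rewrite (not_has_bad_pair nb ij) SF.
rewrite mulrDl addrA; apply: le_trans (lerD (lerD (lexx _) (hit_ler q Cg)) (has_bad_pair_ler q)).
rewrite -!natrD ler_nat; apply: leq_trans (subset_leq_card sub) _.
by apply: leq_trans (leq_card_setU _ _) _; rewrite leq_add2r leq_card_setU.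
Qed.

Lemma card_lift_seqs q (Y : {set {ffun 'I_q -> 'I_m}}) (a : R) :
  0 <= a -> (forall i, a <= #|[set u | phi u == i]|%:R) ->
  #|Y|%:R * a ^+ q <= #|[set s : {ffun 'I_q -> T} | [ffun i => phi (s i)] \in Y]|%:R.
Proof.
move=> a0 ha; pose p (s : {ffun 'I_q -> T}) := [ffun i => phi (s i)].
rewrite -[X in _ <= X%:R]sum1_card (partition_big p [in Y]) /=; last by move=> s; rewrite inE.
rewrite natr_sum mulrC mulr_natr -sumr_const; apply: ler_sum => y yY.
rewrite sum1dep_card.
have -> : #|[set s | (s \in [set s | p s \in Y]) && (p s == y)]|
    = #|[set s : {ffun 'I_q -> T} | [forall i, s i \in [set u | phi u == y i]]]|.
  apply: eq_card => s; rewrite !inE; apply/andP/forallP => [[_ /eqP <-] i|h].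
    by rewrite inE ffunE.
  suff -> : p s = y by [].
  by apply/ffunP => i; have := h i; rewrite inE ffunE => /eqP.
rewrite card_box natr_prod -[q in _ ^+ q]card_ord -prodr_const.
by apply: ler_prod => i _; rewrite a0 ha.
Qed.

Definition nonnbrs (x : T) (i : 'I_m) : {set T} :=
  [set u | [&& phi u == i, u != x & ~~ adj G x u]].

Definition nbrs (x : T) (i : 'I_m) : {set T} := [set u | (phi u == i) && adj G x u].

(** The set X(x), with almost all meaning all but at most g n vertices, x itself not being counted
    as missed. *)
Definition nbr_classes (g : R) (x : T) : {set 'I_m} :=
  [set i | #|nonnbrs x i|%:R <= g * n].

(** Otherwise l - 1 pairwise nonadjacent classes would each contain more than g n non-neighbours of
    x, and an independent transversal of these together with x would be an independent l-set. *)
Lemma nbr_classes_legal l g x : (2 <= l)%N -> (alpha G < l)%N -> 0 <= g ->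
  (l.-1)%:R ^+ 2 * eta < g ^+ l.-1 -> legal l F (nbr_classes g x).
Proof.
move=> hl aG g0 hg [f [inj fX fI]].
have [| |i|s [sA sI]] := @independent_transversal _ f (fun i => nonnbrs x (f i)) g _ _ g0 hg _.
- move=> i j ij; rewrite in_closed_nbhd (inj_eq inj) (negPf ij) fI.
  by rewrite adj_graph_of andbF.
- by move=> i u; rewrite inE => /and3P[/eqP].
- by have := fX i; rewrite !inE -ltNge => /ltW.
have sx i : s i != x by have := sA i; rewrite inE => /and3P[].
have xs i : ~~ adj G x (s i) by have := sA i; rewrite inE => /and3P[].
have injs : injective s.
  move=> i j E; apply: inj.
  by have := sA i; have := sA j; rewrite !inE E => /and3P[/eqP <- _ _] /and3P[/eqP <-].
suff iA : independent G (x |: [set s i | i : 'I_l.-1]).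
  have := independent_leq_alpha iA; rewrite cardsU1 card_imset // card_ord.
  rewrite (_ : x \notin _); first by rewrite add1n prednK ?(ltnW hl) // leqNgt aG.
  by apply/imsetP => -[i _ E]; have := sx i; rewrite E eqxx.
apply/independentP => u v /setU1P[->|/imsetP[i _ ->]] /setU1P[->|/imsetP[j _ ->]].
- by rewrite adj_irrefl.
- exact: xs.
- by rewrite adj_sym.
- by case: (eqVneq i j) => [->|/sI//]; rewrite adj_irrefl.
Qed.

(** Two disjoint families of sequences near x are counted: [S1], following clique sequences of [F]
    inside X(x), gives the gradient, and [S2], inside a set [A] of neighbours in a further class,
    gives b^q. The errors come from non-neighbours of x in the classes of X(x), from bad pairs, and
    from class sizes falling below n / m. *)
Lemma grad_extra_ler q (g b : R) (x : T) (t : 'I_m) (A : {set T}) :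
  (0 < q)%N -> 0 <= b -> 1 <= g * n -> m%:R <= n ->
  (forall i, n / m%:R - 1 <= #|[set u | phi u == i]|%:R) ->
  (forall u, u \in A -> [/\ adj G x u, phi u = t & t \notin nbr_classes g x]) ->
  b * n <= #|A|%:R ->
  (grad R q.+1 F (nbr_classes g x) + b ^+ q) * n ^+ q
    <= #|nbr_seqs q G x|%:R
       + (q%:R * (2 * m%:R * g) + q%:R ^+ 2 * eta + q%:R * (m%:R / n)) * n ^+ q.
Proof.
move=> q0 b0 gn mn bal AP bA.
set X := nbr_classes g x in AP *.
have m0 : (0 < m)%N by case: (m) (phi x) => // -[].
have mR : 0 < m%:R :> R by rewrite ltr0n.
pose GS := [set y : {ffun 'I_q -> 'I_m} | [forall i, y i \in X] &&
      [forall i, forall j, adj F (y i) (y j) || (y i == y j)]].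
pose S1 := [set s : {ffun 'I_q -> T} | [ffun i => phi (s i)] \in GS].
pose S2 := [set s : {ffun 'I_q -> T} | [forall i, s i \in A]].
pose C := [set u | (phi u \in X) && ~~ adj G x u].
(* Each of the at most m classes in [X] contributes at most g n vertices. The vertex x itself may
   also lie in [C]; as 1 <= g n, doubling absorbs it. *)
have C_leq : #|C|%:R <= 2 * m%:R * g * n.
  have sub : C \subset x |: \bigcup_(i in X) nonnbrs x i.
    apply/subsetP => u; rewrite !inE => /andP[uX xu]; case: eqVneq => //= ux.
    by apply/bigcupP; exists (phi u); rewrite inE ?eqxx ?ux.
  have h : (#|C| <= 1 + \sum_(i in X) #|nonnbrs x i|)%N.
    apply: leq_trans (subset_leq_card sub) _; rewrite cardsU1.
    apply: leq_add; first by case: (x \notin _).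
    elim/big_rec2: _ => [|i y S _ IH]; first by rewrite cards0.
    by apply: leq_trans (leq_card_setU _ _) _; rewrite leq_add2l.
  have gn0 : 0 <= g * n by apply: le_trans gn.
  apply: (@le_trans _ _ (1 + m%:R * (g * n))).
    move: h; rewrite -(ler_nat R) natrD natr_sum => /le_trans; apply; rewrite lerD2l.
    apply: (@le_trans _ _ (\sum_(i in X) g * n)).
      by apply: ler_sum => i; rewrite inE.
    rewrite sumr_const -[leLHS]mulr_natl ler_wpM2r // ler_nat.
    by rewrite -[leqRHS]card_ord max_card.
  have : 1 <= m%:R * (g * n).
    by apply: le_trans gn _; rewrite ler_peMl // ler1n.
  by rewrite -!mulrA; lra.
clearbody X.
have S12 : [disjoint S1 & S2].
  apply/pred0P => s /=; apply/negP; rewrite !inE => /andP[/andP[/forallP sX _] /forallP sA].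
  have := sX (Ordinal q0); rewrite ffunE; have [_ -> /negPf->//] := AP _ (sA (Ordinal q0)).
have := @nbr_seqs_ler q x (S1 :|: S2) C _ C_leq.
rewrite cardsU disjoint_setI0 // cards0 subn0 natrD => /(_ _ _)/wrap[||].
- move=> s; rewrite !inE => /orP[/andP[/forallP sX _]|/forallP sA] i.
    by have := sX i; rewrite ffunE [_ \in C]inE => ->; case: (adj G x _).
  by have [-> _ _] := AP _ (sA i); rewrite orbT.
- move=> s; rewrite !inE => /orP[/andP[_ /forallP sF]|/forallP sA] i j.
    have /forallP/(_ j) := sF i; rewrite !ffunE in_closed_nbhd orbC.
    by [].
  by have [_ -> _] := AP _ (sA i); have [_ -> _] := AP _ (sA j); rewrite in_closed_nbhd eqxx.
move=> h.
have h2 : b ^+ q * n ^+ q <= #|S2|%:R.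
  rewrite /S2 card_box natr_prod -exprMn -[q in _ ^+ q]card_ord -prodr_const.
  by apply: ler_prod => i _; rewrite bA mulr_ge0 // ltW.
have mn0 : 0 <= n / m%:R - 1 by rewrite subr_ge0 ler_pdivlMr // mul1r.
have h1 := card_lift_seqs GS mn0 bal.
have mn1 : 0 <= m%:R / n <= 1 by rewrite divr_ge0 ?(ltW n0) //= ler_pdivrMr // mul1r.
have g1 : grad R q.+1 F X <= 1.
  by rewrite /grad ler_pdivrMr ?ltr0n ?mul1r ?ler_nat ?max_card // card_ffun !card_ord expn_gt0 m0.
have g0 : 0 <= grad R q.+1 F X by rewrite /grad divr_ge0.
have h3 : grad R q.+1 F X * (1 - m%:R / n) ^+ q * n ^+ q <= #|S1|%:R.
  apply: le_trans h1; rewrite /grad -/GS card_ffun !card_ord natrX.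
  rewrite -!mulrA ler_wpM2l // mulrA mulrC -exprVn -!exprMn.
  rewrite (_ : n * (m%:R^-1 * (1 - m%:R / n)) = n / m%:R - 1) //; field.
  by rewrite !gt_eqF.
have := bernoulli_ler q mn1.
set gX := grad _ _ _ _ in g0 g1 h3 *; set u := _ ^+ q in h3 * => hu.
have nq : 0 < n ^+ q by rewrite exprn_gt0.
have h4 : gX * (1 - q%:R * (m%:R / n)) <= gX * u by rewrite ler_wpM2l.
have h5 : gX * (q%:R * (m%:R / n)) <= 1 * (q%:R * (m%:R / n)).
  by rewrite ler_wpM2r // mulr_ge0 // divr_ge0 // ltW.
have h6 : (gX - q%:R * (m%:R / n)) * n ^+ q <= gX * u * n ^+ q.
  by rewrite ler_wpM2r ?(ltW nq) //; lra.
lra.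
Qed.

End Approximation.

(** If X(x) differs from N[i] at j, then x starts at least g n bad pairs: more than g n
    non-neighbours if j is in N[i], and otherwise the class of j without x and at most g n
    non-neighbours. If this held for all x in class i, there would be too many bad pairs. *)
Lemma exists_typical (R : realType) (T : finType) (G : sgraph T) (m : nat)
    (F : sgraph 'I_m) (phi : T -> 'I_m) (g : R) (i : 'I_m) :
  0 <= g * #|T|%:R ->
  (forall j, 2 * (g * #|T|%:R) + 1 <= #|[set u | phi u == j]|%:R) ->
  #|bad_pairs G F phi|%:R < #|[set u | phi u == i]|%:R * (g * #|T|%:R) ->
  exists x, phi x = i /\ nbr_classes G phi g x = closed_nbhd F i.
Proof.
set n := _%:R; move=> gn0 big few.
have [|] := boolP [exists x, (phi x == i) && (nbr_classes G phi g x == closed_nbhd F i)].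
  by case/existsP=> x /andP[/eqP px /eqP E]; exists x.
move=> /existsPn none; exfalso; move: few; apply/negP; rewrite -leNgt.
have many x : phi x == i -> g * n <= #|[set u | (x, u) \in bad_pairs G F phi]|%:R.
  move=> px; have := none x; rewrite px /=.
  have [//|[j /eqP]] : nbr_classes G phi g x = closed_nbhd F i \/
      exists j, (j \in nbr_classes G phi g x) <> (j \in closed_nbhd F i).
    have [/forallP h|/forallPn[j /eqP h]] := boolP
        [forall j, (j \in nbr_classes G phi g x) == (j \in closed_nbhd F i)].
      by left; apply/setP => j; apply/eqP.
    by right; exists j.
  - by move=> ->; rewrite eqxx.
  case jN: (j \in closed_nbhd F i); rewrite inE.
    rewrite eqb_id -ltNge => /ltW h _; apply: le_trans h _; rewrite ler_nat.
    apply/subset_leq_card/subsetP => u.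
    rewrite [_ \in nonnbrs _ _ _ _]inE => /and3P[/eqP uj _ /negPf xu].
    by rewrite 2!inE /= uj xu (eqP px) jN.
  rewrite eqbF_neg negbK => h _.
  have sub : [set u | phi u == j] \subset
      x |: nonnbrs G phi x j :|: [set u | (x, u) \in bad_pairs G F phi].
    apply/subsetP => u; rewrite inE => /eqP uj.
    rewrite in_setU in_setU1 2![in X in _ || X]inE inE uj eqxx (eqP px) jN /=.
    by case: (u == x) => //=; case: (adj G x u).
  have le1 : (#|[set u | phi u == j]| <= 1 + #|nonnbrs G phi x j|
      + #|[set u | (x, u) \in bad_pairs G F phi]|)%N.
    apply: leq_trans (subset_leq_card sub) _.
    apply: leq_trans (leq_card_setU _ _) _; rewrite leq_add2r cardsU1 leq_add2r.
    by case: (x \notin _).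
  move: le1 (big j); rewrite -(ler_nat R) !natrD; lra.
have -> : #|bad_pairs G F phi| = (\sum_x #|[set u | (x, u) \in bad_pairs G F phi]|)%N.
  rewrite -sum1_card big_mkcond (eq_bigr (fun p =>
    if (p.1, p.2) \in bad_pairs G F phi then 1%N else 0%N)); last by case.
  rewrite -(pair_bigA _ (fun x u => if (x, u) \in bad_pairs G F phi then 1%N else 0%N)) /=.
  by apply: eq_bigr => x _; rewrite -sum1dep_card [RHS]big_mkcond.
rewrite mulr_natl -sumr_const natr_sum big_mkcond; apply: ler_sum => x _.
by case: ifP => // xi; apply: many; rewrite inE in xi.
Qed.

(** * Partitions as class maps *)

Lemma vertex_partition_classes (T : finType) (m : nat) (V : 'I_m -> {set T}) :
  vertex_partition V -> exists phi : T -> 'I_m, forall x i, (x \in V i) = (phi x == i).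
Proof.
case=> injV /and3P[/eqP cov /trivIsetP triv _].
have ex x : exists i, x \in V i.
  have : x \in [set: T] by [].
  by rewrite -cov => /bigcupP[_ /imsetP[i _ ->] xi]; exists i.
exists (fun x => xchoose (ex x)) => x i.
have xx := xchooseP (ex x); apply/idP/eqP => [xi|<-//].
apply/eqP; apply: contraLR xi => ne.
have := triv (V (xchoose (ex x))) (V i); rewrite !imset_f // (inj_eq injV).
by move=> /(_ isT isT ne)/disjointFr/(_ xx)->.
Qed.

Lemma classes_vertex_partition (T : finType) (m : nat) (phi : T -> 'I_m) :
  (forall i, exists x, phi x = i) ->
  vertex_partition (fun i => [set x | phi x == i]).
Proof.
move=> sur; split.
  move=> i j /setP E; have [x xi] := sur i.
  by have := E x; rewrite !inE xi eqxx => /esym/eqP.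
apply/and3P; split.
- apply/eqP/setP => x; rewrite inE; apply/bigcupP.
  by exists [set y | phi y == phi x]; rewrite ?inE // (imset_f (fun i => [set y | phi y == i])).
- apply/trivIsetP => _ _ /imsetP[i _ ->] /imsetP[j _ ->] ij.
  rewrite disjoint_subset; apply/subsetP => x; rewrite !inE => /eqP xi.
  by apply: contraNneq ij => xj; rewrite -xi -xj.
- apply/imsetP => -[i _ /setP E]; have [x xi] := sur i.
  by have := E x; rewrite !inE xi eqxx.
Qed.

Lemma adj_expansion (T : finType) (m : nat) (F : sgraph 'I_m) (V : 'I_m -> {set T})
    (phi : T -> 'I_m) x y :
  (forall x i, (x \in V i) = (phi x == i)) ->
  adj (expansion F V) x y = (x != y) && (phi y \in closed_nbhd F (phi x)).
Proof.
move=> Vphi.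
have E u v : [exists i, exists j, [&& u \in V i, v \in V j & (i == j) || adj F i j]]
    = (phi v \in closed_nbhd F (phi u)).
  rewrite in_closed_nbhd; apply/existsP/idP => [[i /existsP[j]]|h].
    by rewrite !Vphi => /and3P[/eqP-> /eqP->].
  by exists (phi u); apply/existsP; exists (phi v); rewrite !Vphi !eqxx.
by rewrite adj_graph_of !E (closed_nbhd_sym F (phi y)) orbb.
Qed.

Lemma card_bad_pairs (T : finType) (G : sgraph T) (m : nat) (F : sgraph 'I_m)
    (V : 'I_m -> {set T}) (phi : T -> 'I_m) :
  (forall x i, (x \in V i) = (phi x == i)) ->
  (#|bad_pairs G F phi|
    <= #|T| + 2 * #|sym_diff (edges (expansion F V)) (edges G)|)%N.
Proof.
move=> Vphi; set D := sym_diff _ _.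
pose B1 := [set p : T * T | (p.1 != p.2) && ([set p.1; p.2] \in D)].
have sub : bad_pairs G F phi \subset [set (x, x) | x : T] :|: B1.
  apply/subsetP => -[x y]; rewrite !inE /=; have [->|xy] := eqVneq x y.
    by rewrite orbC imset_f.
  rewrite -/(adj (expansion F V) x y) -/(adj G x y).
  rewrite (adj_expansion _ _ _ Vphi) xy /= in_closed_nbhd (eq_sym (phi x)) => bad.
  by apply/orP; right; move: bad; case: (adj G x y); case: (_ || _).
apply: leq_trans (subset_leq_card sub) _; apply: leq_trans (leq_card_setU _ _) _.
apply: leq_add; first exact: leq_imset_card.
(* The bit tells which end comes first in the enumeration of [T], so each edge of the difference
   accounts for at most two ordered pairs. *)
pose h (p : T * T) := ([set p.1; p.2], (enum_rank p.1 < enum_rank p.2)%N).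
rewrite -(@card_in_imset _ _ h B1) => [|[x y] [u v]]; last first.
  rewrite !inE /= => /andP[xy _] _ [/eq_set2[[-> ->] //|[-> ->]]] E.
  by move: E; case: ltngtP => // /val_inj/enum_rank_inj ->.
rewrite mulnC -card_bool -cardsT -cardsX; apply/subset_leq_card/subsetP.
by move=> _ /imsetP[p + ->]; rewrite !inE => /andP[_ ->].
Qed.

(** A finite function has a least value above [c]; the cap 1 covers the case of no such value.
    Applied to [grad], it turns a gradient below c + e into one at most c. *)
Lemma finite_gap (R : realFieldType) (I : finType) (f : I -> R) (c : R) :
  exists2 e : R, 0 < e & forall i, c < f i -> c + e <= f i.
Proof.
exists (\big[Order.min/1]_(i | c < f i) (f i - c)).
  by apply: lt_bigmin => // i ci; rewrite subr_gt0.
by move=> i ci; rewrite -lerBrDl; exact: bigmin_le_cond.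
Qed.

(** The entries after a first entry i form a sequence counted by the gradient of N[i]. With
    [c_lim_le_blowup] this shows that these gradients average at least c. *)
Lemma clique_seqs_leq_sum_grad (R : realType) (m q : nat) (F : sgraph 'I_m) :
  (0 < m)%N ->
  #|clique_seqs q.+1 F|%:R / m%:R ^+ q <= \sum_i grad R q.+1 F (closed_nbhd F i).
Proof.
move=> m0.
rewrite /grad -mulr_suml card_ffun !card_ord natrX ler_pM2r; last first.
  by rewrite invr_gt0 exprn_gt0 ?ltr0n.
rewrite -natr_sum ler_nat -sum1_card.
rewrite (partition_big (fun s : {ffun 'I_q.+1 -> 'I_m} => s ord0) predT) //=.
apply: leq_sum => i _; rewrite sum1dep_card.
pose tl (s : {ffun 'I_q.+1 -> 'I_m}) := [ffun a : 'I_q => s (lift ord0 a)].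
rewrite -(@card_in_imset _ _ tl) => [|s t]; last first.
  rewrite !inE => /andP[_ /eqP s0] /andP[_ /eqP t0] /ffunP E; apply/ffunP => a.
  by case: (unliftP ord0 a) => [b|] ->; [have := E b; rewrite !ffunE | rewrite s0].
apply/subset_leq_card/subsetP => _ /imsetP[s + ->]; rewrite !inE => /andP[/forallP cs /eqP s0].
have {}cs a b : adj F (s a) (s b) || (s a == s b) by have /forallP := cs a.
apply/andP; split; apply/forallP => a.
  by rewrite ffunE in_closed_nbhd -s0 orbC.
by apply/forallP => b; rewrite !ffunE.
Qed.

(** The constant sequence j is counted for [X] but not for [X :\ j]. *)
Lemma grad_D1_lt (R : realType) (m q : nat) (F : sgraph 'I_m) (X : {set 'I_m}) j :
  (0 < q)%N -> j \in X -> grad R q.+1 F (X :\ j) < grad R q.+1 F X.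
Proof.
move=> q0 jX; rewrite /grad ltr_pM2r; last first.
  rewrite invr_gt0 ltr0n card_ffun !card_ord expn_gt0.
  by case: (m) j {jX} => [[]|].
rewrite ltr_nat; apply: proper_card; apply/properP; split.
  apply/subsetP => s; rewrite !inE => /andP[/forallP sX ->]; rewrite andbT.
  by apply/forallP => a; have := sX a; rewrite !inE => /andP[].
exists [ffun=> j]; rewrite !inE.
  apply/andP; split; apply/forallP => a; first by rewrite ffunE.
  by apply/forallP => b; rewrite !ffunE eqxx orbT.
rewrite negb_and; apply/orP; left; apply/forallPn; exists (Ordinal q0).
by rewrite ffunE !inE eqxx.
Qed.

(** * Extremal graphs *)

Section Structure.
Variables (R : realType) (q l m : nat) (F : sgraph 'I_m).
Variables (T : finType) (G : sgraph T) (phi : T -> 'I_m) (e g eta : R).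
Hypotheses (q0 : (0 < q)%N) (m0 : (0 < m)%N) (aF : (alpha F < l.+2)%N).
Hypothesis strictF : forall X : {set 'I_m}, legal l.+2 F X ->
  ~ (exists i, X = closed_nbhd F i) -> c_lim R q.+1 l.+2 < grad R q.+1 F X.
Hypotheses (aG : (alpha G < l.+2)%N)
  (extG : num_cliques q.+1 G = f_min #|T| q.+1 l.+2).

Notation n := (#|T|%:R : R).
Notation c := (c_lim R q.+1 l.+2).
Notation mR := (m%:R : R).
(** Here b n is a quarter of n / m. A class from which two vertices and two sets of fewer than b n
    vertices are removed still has at least b n elements. *)
Notation b := ((4 * m%:R)^-1 : R).
Notation X := (nbr_classes G phi g).
Notation N := (closed_nbhd F).

Hypothesis gap : forall Y : {set 'I_m},
  c < grad R q.+1 F Y -> c + e <= grad R q.+1 F Y.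
Hypotheses (e_le : e <= b ^+ q) (g0 : 0 < g) (gb : g <= b).
Hypotheses (g_small : q%:R * (2 * mR * g) <= e / 4)
  (eta_small : q%:R ^+ 2 * eta <= e / 4) (n_large : q%:R * (mR + 1) / n < e / 4).
Hypotheses (eta_power : (l.+2)%:R ^+ 2 * eta < g ^+ l.+2)
  (eta0 : 0 <= eta) (eta_g : eta < g / (2 * mR)).
Hypotheses (gn1 : 1 <= g * n) (mn : 12 * mR <= n).
Hypothesis bad_leq : #|bad_pairs G F phi|%:R <= eta * n ^+ 2.
Hypothesis bal : forall i, n / mR - 1 <= #|[set u | phi u == i]|%:R.

Let mR0 : 0 < mR. Proof. by rewrite ltr0n. Qed.
Let mR1 : 1 <= mR. Proof. by rewrite ler1n. Qed.
Let n0 : 0 < n. Proof. have := mn; have := mR1; lra. Qed.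
Let b0 : 0 < b. Proof. by rewrite invr_gt0 mulr_gt0. Qed.
Let b1 : b <= 1. Proof. by rewrite invf_le1 ?mulr_gt0 //; have := mR1; lra. Qed.
Let nmb : n / mR = 4 * (b * n).
Proof. by field; rewrite gt_eqF. Qed.
Let bn3 : 3 <= b * n.
Proof. by rewrite mulrC ler_pdivlMr ?mulr_gt0 //; have := mn; lra. Qed.
Let gbn : g * n <= b * n. Proof. by rewrite ler_pM2r. Qed.

(** As g <= 1, the single hypothesis [eta_power] covers both transversals: l + 1 sets of density g
    for legality, and l sets of density b for the final contradiction. *)
Let eta_power_le r (a : R) : (r <= l.+2)%N -> g <= a -> r%:R ^+ 2 * eta < a ^+ r.
Proof.
move=> rl ga; apply: (@le_lt_trans _ _ ((l.+2)%:R ^+ 2 * eta)).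
  by rewrite ler_wpM2r // lerXn2r ?nnegrE // ler_nat.
apply: lt_le_trans eta_power _; apply: (@le_trans _ _ (g ^+ r)).
  by rewrite ler_wiXn2l ?(ltW g0) // (le_trans gb b1).
by rewrite lerXn2r ?nnegrE ?(ltW g0) // (le_trans (ltW g0)).
Qed.

Let X_legal x : legal l.+2 F (X x).
Proof.
apply: (nbr_classes_legal n0 bad_leq) => //; first exact: ltW.
exact: eta_power_le.
Qed.

(** The lower bound of [grad_extra_ler] meets the upper bound from cloning. The errors, with m / n
    and q-fold 1 / n terms merged, are three quantities of size at most e / 4. *)
Let grad_extra (x : T) (t : 'I_m) (A : {set T}) (a : R) : 0 <= a ->
  (forall u, u \in A -> [/\ adj G x u, phi u = t & t \notin X x]) ->
  a * n <= #|A|%:R ->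
  grad R q.+1 F (X x) + a ^+ q < c + e.
Proof.
move=> a0 AP aA.
have mn' : mR <= n by have := mn; have := mR0; lra.
have low := grad_extra_ler n0 bad_leq q0 a0 gn1 mn' bal AP aA.
have up := card_nbr_seqs_leq R x q0 (isT : (2 <= l.+2)%N) aG extG.
have nq : 0 < n ^+ q by rewrite exprn_gt0.
have := le_trans low (lerD up (lexx _)); rewrite -mulrDl ler_pM2r //.
have E : q%:R * (mR + 1) / n = q%:R * (mR / n) + q%:R / n by field; rewrite gt_eqF.
have : 0 <= q%:R * (mR + 1) / n by rewrite divr_ge0 ?mulr_ge0 ?addr_ge0.
move: n_large g_small eta_small; rewrite E; lra.
Qed.

Let grad_X x : grad R q.+1 F (X x) <= c.
Proof.
(* With no extra neighbours the gradient is below c + e, and [gap] improves this to at most c. *)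
have := @grad_extra x (phi x) set0 0 (lexx _); rewrite mul0r cards0 expr0n eqn0Ngt q0 addr0.
move=> h; rewrite leNgt; apply/negP => /gap; apply/negP; rewrite -ltNge.
by apply: h => // u; rewrite inE.
Qed.

Let X_closed x : [exists i, X x == N i].
Proof.
apply: contraT => /existsPn h; have := grad_X x; rewrite leNgt strictF //.
by case=> i E; have := h i; rewrite E eqxx.
Qed.

Let typical i : exists x, phi x = i /\ X x = N i.
Proof.
apply: exists_typical.
- by rewrite mulr_ge0 // ltW.
- by move=> j; apply: le_trans (bal j); rewrite nmb; have := gbn; have := bn3; lra.
apply: le_lt_trans bad_leq _; rewrite expr2 mulrA [ltRHS]mulrA ltr_pM2r //.
apply: (@lt_le_trans _ _ (g / (2 * mR) * n)); first by rewrite ltr_pM2r.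
rewrite (_ : g / (2 * mR) * n = n / mR / 2 * g); last by field; rewrite gt_eqF.
rewrite ler_pM2r //; apply: le_trans (bal i); have := bn3; rewrite nmb; lra.
Qed.

(** Typical vertices show that each of these gradients is at most c, while blowups of [F] force
    their average to be at least c. *)
Let grad_N i : grad R q.+1 F (N i) = c.
Proof.
have le_c j : grad R q.+1 F (N j) <= c by have [x [_ <-]] := typical j.
apply/eqP; rewrite eq_le le_c /= leNgt; apply/negP => lt_c.
have := c_lim_le_blowup R q.+1 (isT : (2 <= l.+2)%N) m0 aF.
apply/negP; rewrite -ltNge exprSr invfM mulrA ltr_pdivrMr //.
apply: le_lt_trans (clique_seqs_leq_sum_grad R q F m0) _.
rewrite mulr_natr -[m in _ *+ m]card_ord -sumr_const.
by rewrite (bigD1 i) //= [ltRHS](bigD1 i) //= ltr_leD // ler_sum.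
Qed.

(** With b n such neighbours, [grad_extra] would give c + b^q < c + e, against the choice of e. *)
Let nbrs_lt x t : t \notin X x -> #|nbrs G phi x t|%:R < b * n.
Proof.
move=> tX; rewrite ltNge; apply/negP => h.
have AP u : u \in nbrs G phi x t -> [/\ adj G x u, phi u = t & t \notin X x].
  by rewrite inE => /andP[/eqP].
have := grad_extra (ltW b0) AP h.
by have /existsP[i /eqP ->] := X_closed x; rewrite grad_N ltrD2l ltNge e_le.
Qed.

(** Removing j pushes the gradient below c, whereas a legal set has gradient equal to c if it is a
    closed neighbourhood and above c if not. *)
Let not_legal_D1 i j : j \in N i -> ~ legal l.+2 F (N i :\ j).
Proof.
move=> jN leg; have := grad_D1_lt R F q0 jN; rewrite grad_N.
have [/existsP[i' /eqP ->]|/existsPn h] := boolP [exists i', N i :\ j == N i'].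
  by rewrite grad_N ltxx.
apply/negP; rewrite -leNgt ltW // strictF // => -[i' E].
by have := h i'; rewrite E eqxx.
Qed.

Let adj_typed x y i j : X x = N i -> X y = N j -> j \in N i -> x != y -> adj G x y.
Proof.
move=> Xx Xy jN xy; apply: contraT => nxy; case: (not_legal_D1 jN) => -[f [finj fN fI]].
(* The independent set [f] must contain j, since otherwise it would avoid N[i], which is legal as X
   of a typical vertex. Its other elements avoid N[i], and also N[j] by independence. *)
have [a0 f'P] : exists a0, forall a, a != a0 -> f a \notin N i /\ f a \notin N j.
  have [/existsP[a0 /eqP fa0]|/existsPn none] := boolP [exists a, f a == j].
    exists a0 => a aa0; have := fN a; rewrite !in_setC in_setD1.
    have faj : f a != j by rewrite -fa0 (inj_eq finj).
    rewrite faj /= => ->; split=> //.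
    by rewrite in_closed_nbhd eq_sym (negPf faj) /= -fa0 fI adj_graph_of andbF.
  have [x0 [_ E]] := typical i; case: (@X_legal x0); exists f; split=> // a.
  by have := fN a; rewrite E !in_setC in_setD1 none.
pose f' a := f (lift a0 a).
have {}f'P a : f' a \notin N i /\ f' a \notin N j by apply: f'P; rewrite eq_sym neq_lift.
(* These are common non-neighbours of x and y; one from each of the l classes, chosen independently,
   completes {x, y} to an independent set of size l + 2. *)
pose A a := [set u | phi u == f' a] :\: (x |: (y |: (nbrs G phi x (f' a) :|: nbrs G phi y (f' a)))).
have Aphi a u : u \in A a -> phi u = f' a.
  by rewrite in_setD inE => /andP[_ /eqP].
have big a : b * n <= #|A a|%:R.
  have [fi fj] := f'P a.
  have nx : #|nbrs G phi x (f' a)|%:R < b * n by apply: nbrs_lt; rewrite Xx.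
  have ny : #|nbrs G phi y (f' a)|%:R < b * n by apply: nbrs_lt; rewrite Xy.
  have h : (#|[set u | phi u == f' a]| <=
      1 + (1 + (#|nbrs G phi x (f' a)| + #|nbrs G phi y (f' a)|)) + #|A a|)%N.
    rewrite -(cardsID (x |: (y |: (nbrs G phi x (f' a) :|: nbrs G phi y (f' a)))))
      leq_add2r; apply: leq_trans (subset_leq_card (subsetIr _ _)) _.
    rewrite cardsU1 leq_add ?leq_b1 // cardsU1 leq_add ?leq_b1 //.
    exact: leq_card_setU.
  move: h (bal (f' a)); rewrite -(ler_nat R) !natrD nmb; have := bn3; lra.
have [| | | | |s [sA sI]] := @independent_transversal _ _ G _ F phi n0 eta bad_leq _ f' A b.
- move=> a a' aa'; rewrite in_closed_nbhd fI adj_graph_of andbF orbF.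
  by rewrite (inj_eq finj) (inj_eq (@lift_inj _ _)).
- exact: Aphi.
- exact: ltW.
- by apply: eta_power_le => //; rewrite ltnW.
- exact: big.
have sP a : [/\ s a != x, s a != y, ~~ adj G x (s a) & ~~ adj G y (s a)].
  have := sA a; rewrite in_setD !in_setU !in_set1 !negb_or => /andP[/and4P[-> ->]].
  by rewrite !inE => + + sc; rewrite sc /= => -> ->.
have injs : injective s.
  move=> a a' E; apply: (@lift_inj _ a0); apply: finj.
  by rewrite -/(f' a) -/(f' a') -(Aphi _ _ (sA a)) -(Aphi _ _ (sA a')) E.
have xs : x \notin [set s a | a : 'I_l].
  by apply/imsetP => -[a _ E]; have [/eqP] := sP a; rewrite E.
have ys : y \notin [set s a | a : 'I_l].
  by apply/imsetP => -[a _ E]; have [_ /eqP] := sP a; rewrite E.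
suff iA : independent G (x |: (y |: [set s a | a : 'I_l])).
  have := independent_leq_alpha iA; rewrite !cardsU1 card_imset // card_ord.
  by rewrite ys in_setU1 (negPf xy) (negPf xs) /= leqNgt aG.
apply/independentP => u v.
move=> /setU1P[->|/setU1P[->|/imsetP[a _ ->]]] /setU1P[->|/setU1P[->|/imsetP[a' _ ->]]];
  rewrite ?adj_irrefl // ?(adj_sym G y x) //.
- by have [] := sP a'.
- by have [] := sP a'.
- by have [_ _ + _] := sP a; rewrite adj_sym.
- by have [_ _ _] := sP a; rewrite adj_sym.
- by case: (eqVneq a a') => [->|/sI//]; rewrite adj_irrefl.
Qed.

Lemma extremal_contains_expansion :
  exists2 psi : T -> 'I_m, forall i, exists x, psi x = i &
    forall x y, x != y -> psi y \in N (psi x) -> adj G x y.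
Proof.
have ex x : exists i, X x == N i by apply/existsP.
(* Distinct vertices of [F] may have the same closed neighbourhood. Keeping [phi x] whenever it fits
   leaves typical vertices in place, so every class is nonempty. *)
pose psi x := if X x == N (phi x) then phi x else xchoose (ex x).
have Xpsi x : X x = N (psi x).
  by rewrite /psi; case: ifP => [/eqP //|_]; apply/eqP; exact: (xchooseP (ex x)).
exists psi => [i|x y xy h]; last exact: adj_typed h xy.
have [x [xi E]] := typical i; exists x; rewrite /psi.
by have -> : X x == N (phi x) by rewrite xi E.
Qed.

End Structure.

(** * Choice of the constants *)

Lemma balanced_class_ge (R : realType) (T : finType) (m : nat) (phi : T -> 'I_m) :
  (0 < m)%N ->
  (forall i j, (#|[set u | phi u == i]| <= #|[set u | phi u == j]| + 1)%N) ->
  forall i, #|T|%:R / m%:R - 1 <= #|[set u | phi u == i]|%:R :> R.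
Proof.
move=> m0 bal i; rewrite lerBlDr ler_pdivrMr ?ltr0n // natr1 -natrM ler_nat.
have -> : #|T| = (\sum_(j < m) #|[set u | phi u == j]|)%N.
  rewrite -sum1_card (partition_big phi predT) //=.
  by apply: eq_bigr => j _; rewrite sum1dep_card.
apply: (@leq_trans (\sum_(j < m) #|[set u | phi u == i]|.+1)%N).
  by apply: leq_sum => j _; rewrite -addn1.
by rewrite sum_nat_const card_ord mulnC.
Qed.

Lemma natr_gt_eventually (R : realType) (x : R) :
  exists n0 : nat, forall n, (n0 <= n)%N -> x < n%:R.
Proof.
exists (Num.truncn x).+1 => n h; apply: lt_le_trans (truncnS_gt x) _.
by rewrite ler_nat.
Qed.

Lemma extremal_dense (R : realType) (k l : nat) (T : finType) (G : sgraph T) :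
  (2 <= l)%N -> num_cliques k G = f_min #|T| k l ->
  clique_density R k G <= c_lim R k l.
Proof. by move=> hl; rewrite /clique_density => ->; exact: dens_le_c_lim. Qed.

(** Stability, applied to an extremal graph with at least one vertex, yields a class containing that
    vertex. *)
Lemma stability_graph_gt0 (R : realType) (k l m : nat) (F : sgraph 'I_m) :
  (2 <= l)%N -> stability_graph R k l F -> (0 < m)%N.
Proof.
move=> hl [_ /(_ 1 ltr01)[n1 [d [d0 stable]]]].
have [G aG ext] := f_min_attained k hl n1.+1.
have [||V [/vertex_partition_classes[phi _] _ _]] := stable _ G _ aG.
- by rewrite card_ord.
- have := @extremal_dense R k l _ G hl; rewrite card_ord => /(_ ext)/le_trans.
  by apply; rewrite lerDl ltW.
exact: leq_ltn_trans (ltn_ord (phi ord0)).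
Qed.

Lemma extremal_contains_expansion_eventually (R : realType) (q l m : nat)
    (F : sgraph 'I_m) :
  (0 < q)%N -> strict_stability_graph R q.+1 l.+2 F ->
  exists n0 : nat, forall (T : finType) (G : sgraph T),
    (n0 <= #|T|)%N -> (alpha G < l.+2)%N ->
    num_cliques q.+1 G = f_min #|T| q.+1 l.+2 ->
    exists V : 'I_m -> {set T},
      vertex_partition V /\ edges (expansion F V) \subset edges G.
Proof.
move=> q0 [sF strictF]; have m0 := stability_graph_gt0 (isT : (1 < l.+2)%N) sF.
case: sF => aF stable.
set c := c_lim R q.+1 l.+2.
have mR0 : 0 < m%:R :> R by rewrite ltr0n.
have qR0 : 0 < q%:R :> R by rewrite ltr0n.
have [e1 e10 gap1] := finite_gap (grad R q.+1 F) c.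
pose b : R := (4 * m%:R)^-1.
have b0 : 0 < b by rewrite invr_gt0 mulr_gt0.
pose e := Order.min e1 (b ^+ q).
have e0 : 0 < e by rewrite lt_min e10 exprn_gt0.
pose g := Order.min b (e / (8 * q%:R * m%:R)).
have g0 : 0 < g by rewrite lt_min b0 divr_gt0 ?mulr_gt0.
(* The three bounds give [eta_small], [eta_power] and [eta_g]; the added 1 and the factor 4 make the
   last two strict. *)
pose eta := Order.min (e / (4 * q%:R ^+ 2))
  (Order.min (g ^+ l.+2 / ((l.+2)%:R ^+ 2 + 1)) (g / (4 * m%:R))).
have l0 : 0 < (l.+2)%:R ^+ 2 + 1 :> R by rewrite ltr_wpDl ?exprn_ge0.
have eta0 : 0 < eta.
  rewrite /eta; move: g0; clearbody g => g0.
  by rewrite !lt_min; apply/and3P; split; rewrite divr_gt0 ?exprn_gt0 ?mulr_gt0 ?exprn_gt0.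
(* Half of eta goes to the edges of the difference; the other half pays for the n loops in
   [bad_pairs] once n > 2 / eta. *)
have [n1 [d [d0 Hn1]]] := stable (eta / 2) (divr_gt0 eta0 (ltr0n _ 2)).
have [n2 Hn2] := natr_gt_eventually (4 * (q%:R * (m%:R + 1)) / e).
have [n3 Hn3] := natr_gt_eventually g^-1.
have [n4 Hn4] := natr_gt_eventually (12 * m%:R : R).
have [n5 Hn5] := natr_gt_eventually (2 / eta).
exists (n1 + n2 + n3 + n4 + n5)%N => T G; rewrite -!addnA => hT aG ext.
have {}Hn1 := Hn1 T G (leq_trans (leq_addr _ _) hT) aG.
have {}Hn2 : 4 * (q%:R * (m%:R + 1)) / e < #|T|%:R by apply: Hn2; apply: leq_trans hT; clear; lia.
have {}Hn3 : g^-1 < #|T|%:R by apply: Hn3; apply: leq_trans hT; clear; lia.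
have {}Hn4 : 12 * m%:R < #|T|%:R :> R by apply: Hn4; apply: leq_trans hT; clear; lia.
have {}Hn5 : 2 / eta < #|T|%:R by apply: Hn5; apply: leq_trans hT; clear; lia.
have n0 : 0 < #|T|%:R :> R by apply: lt_trans Hn3; rewrite invr_gt0.
have [|V [/vertex_partition_classes[phi Vphi] balV diffV]] := Hn1.
  apply: le_trans (extremal_dense R (isT : (1 < l.+2)%N) ext) _; rewrite lerDl; exact: ltW.
have VE i : V i = [set u | phi u == i] by apply/setP => u; rewrite inE Vphi.
have bal : forall i, #|T|%:R / m%:R - 1 <= #|[set u | phi u == i]|%:R :> R.
  by apply: balanced_class_ge => // i j; rewrite -!VE.
have bad_leq : #|bad_pairs G F phi|%:R <= eta * #|T|%:R ^+ 2.
  apply: (@le_trans _ _ (#|T|%:R + 2 * (eta / 2 * 'C(#|T|, 2)%:R))).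
    have := card_bad_pairs G F Vphi; rewrite -(ler_nat R) natrD natrM => /le_trans.
    by apply; rewrite lerD2l ler_wpM2l.
  have bin_leq : 'C(#|T|, 2)%:R * 2 <= #|T|%:R ^+ 2 :> R.
    rewrite -natrX -natrM ler_nat; have := bin_ffact #|T| 2.
    rewrite (_ : 2`! = 2)%N // => ->; rewrite ffactnSr ffactn1; clear; nia.
  have n_leq : 2 * #|T|%:R <= eta * #|T|%:R ^+ 2.
    by rewrite expr2 mulrA ler_pM2r // mulrC -ler_pdivrMr // ltW.
  have := ler_wpM2l (ltW eta0) bin_leq; lra.
have gb : g <= b by rewrite /g ge_min lexx.
have g_small : q%:R * (2 * m%:R * g) <= e / 4.
  apply: (@le_trans _ _ (q%:R * (2 * m%:R * (e / (8 * q%:R * m%:R))))).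
    by rewrite ler_wpM2l // ler_wpM2l ?mulr_ge0 // /g ge_min lexx orbT.
  rewrite le_eqVlt; apply/orP; left; apply/eqP; field.
  by rewrite !gt_eqF.
have eta_small : q%:R ^+ 2 * eta <= e / 4.
  apply: (@le_trans _ _ (q%:R ^+ 2 * (e / (4 * q%:R ^+ 2)))).
    by rewrite ler_wpM2l ?exprn_ge0 // /eta ge_min lexx.
  rewrite le_eqVlt; apply/orP; left; apply/eqP; field.
  by rewrite gt_eqF.
have n_large : q%:R * (m%:R + 1) / #|T|%:R < e / 4.
  rewrite ltr_pdivrMr //; move: Hn2; rewrite ltr_pdivrMr //; lra.
have eta_power : (l.+2)%:R ^+ 2 * eta < g ^+ l.+2.
  apply: (@le_lt_trans _ _ ((l.+2)%:R ^+ 2 * (g ^+ l.+2 / ((l.+2)%:R ^+ 2 + 1)))).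
    by rewrite ler_wpM2l ?exprn_ge0 // /eta !ge_min lexx orbT.
  rewrite mulrA ltr_pdivrMr // mulrC ltr_pM2l ?exprn_gt0 //; lra.
have eta_g : eta < g / (2 * m%:R).
  apply: (@le_lt_trans _ _ (g / (4 * m%:R))).
    by rewrite /eta !ge_min lexx !orbT.
  by rewrite ltr_pM2l // ltf_pV2 ?posrE ?mulr_gt0 // ltr_pM2r // ltr_nat.
have gn1 : 1 <= g * #|T|%:R.
  by rewrite -ler_pdivrMl // mulr1 ltW.
have gap (Y : {set 'I_m}) : c < grad R q.+1 F Y -> c + e <= grad R q.+1 F Y.
  by move=> /gap1; apply: le_trans; rewrite lerD2l /e ge_min lexx.
have e_le : e <= b ^+ q by rewrite /e ge_min lexx orbT.
have [psi sur full] := extremal_contains_expansion q0 m0 aF strictF aG ext gap e_le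
  g0 gb g_small eta_small n_large eta_power (ltW eta0) eta_g gn1 (ltW Hn4) bad_leq bal.
exists (fun i => [set u | psi u == i]); split; first exact: classes_vertex_partition.
apply/subsetP => _ /edgeP[x [y [-> xy]]]; move: xy.
rewrite (@adj_expansion _ _ _ _ psi); last by move=> u i; rewrite inE.
by case/andP; exact: full.
Qed.

End RingScope.

Theorem theorem19 (R : realType) (k l m : nat) (F : sgraph 'I_m)
    (hk : 2 <= k) (hl : 2 <= l) (hF : strict_stability_graph R k l F) :
  exists n0 : nat, forall (T : finType) (G : sgraph T),
    n0 <= #|T| -> alpha G < l -> num_cliques k G = f_min #|T| k l ->
    exists V : 'I_m -> {set T},
      vertex_partition V /\ edges (expansion F V) \subset edges G.
Proof.
case: k hk hF => [|[|q]] // _; case: l hl => [|[|l]] // _.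
exact: extremal_contains_expansion_eventually.
Qed.
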